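(* Let $d\ge3$, $\{\mathbb{P}^u\}$ satisfy (P1), (P2), (D), (S1), (S2), fix $u$, $\eta=\eta(u)$. Let $\alpha\in(0,1/3)$, let $\omega$ be such that $\mathcal S_\infty$ is nonempty and connected and $R_{\mathrm{den}}(\omega,\alpha)<\infty$, and let $U_0\subseteq\mathcal S_\infty$. Let integers $\ell>\ell'$ satisfy $2^{\ell}>2^{\ell'}\ge R_{\mathrm{den}}(\omega,\alpha)$ and $r_{\alpha,2^{\ell'}}-2^\ell-2^{\ell'}>0$. (i) For any $x,x+y\in\mathcal S_\infty\cap B(0,r_{\alpha,2^\ell})$ connected by a path in $\mathcal S_\infty\cap B(0,r_{\alpha,2^\ell})$, $|\sigma^\omega_\ell(x)-\sigma^\omega_\ell(x+y)|\le c_{\mathrm{lip}}\widehat d_\omega(x,x+y)$ with $c_{\mathrm{lip}}=6\cdot2^{-\ell}/\eta$, where $\widehat d_\omega$ is the graph distance in $\mathcal S_\infty\cap B(0,r_{\alpha,2^\ell})$. (ii) For $x\in\mathcal S_\infty\cap B(0,r_{\alpha,2^{\ell'}}-2^\ell-2^{\ell'})$, $$(\sigma^\omega_{\ell'})^\omega_{x,\ell}\in\Big[\tfrac{1-\alpha}{1+\alpha}\sigma^\omega_\ell(x)-c_02^{\ell'-\ell},\ \tfrac{1+\alpha}{1-\alpha}\sigma^\omega_\ell(x)+c_02^{\ell'-\ell}\Big],\qquad c_0=\frac{3d\cdot2^{d-1}}{\eta}.$$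
   Context: Framework: $\Omega=\{0,1\}^{\mathbb{Z}^d}$; $\mathcal S=\{x:\omega(x)=1\}$ as nearest-neighbour subgraph; $\mathcal S_\infty$ vertices in infinite components; $B(x,r)$ closed $\ell^\infty$-ball in $\mathbb{Z}^d$. $\mathbb{P}^u$ satisfy (P1) ergodicity of shifts, (P2) monotonicity, (D) sprinkled decoupling $\mathbb{P}^u[A_1\cap A_2]\le\mathbb{P}^{u'}[A_1]\mathbb{P}^{u'}[A_2]+C\exp(-c\min\{(u'-u)^\beta s^\gamma,e^{(\log L)^\zeta}\})$ for increasing events depending on $B(x_i,L)$, $|x_1-x_2|_\infty=sL$, $u<u'$ (and reversed for decreasing events), (S1) local uniqueness with rate $f_S(u,R)\ge(\log R)^{1+\Delta_S(u)}$ (for large $R$; the events $\{\mathcal S_R\cap B(0,R)\ne\emptyset\}$ and $\{$all $x,y$ in $\mathcal S_{R/10}\cap B(0,R)$ connected in $\mathcal S\cap B(0,2R)\}$ have probability $\ge1-e^{-f_S(u,R)}$, $\mathcal S_r$ = vertices in components of $\ell^1$-diameter $\ge r$), (S2) $\eta(u)=\mathbb{P}^u[0\in\mathcal S_\infty]>0$ continuous. $\Delta_S=\Delta_S(u)$. Scales: $r_{\alpha,R}=\exp(\kappa_{\mathrm{reg}}(\alpha)(\log R)^{1+\Delta_S})$ with $\kappa_{\mathrm{reg}}(\alpha)>0$ a fixed function of $\alpha$ (namely $\frac1{2d}(\kappa_{d2}(\alpha)\wedge c_{hk6})$ for the volume large-deviation exponent $\kappa_{d2}$ and heat-kernel tail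 constant $c_{hk6}$). $R_{\mathrm{den}}(\omega,\alpha)=\inf\{R_0\ge1:\forall R\ge R_0,\forall x\in\mathcal S_\infty\cap B(0,r_{\alpha,R}),\ (1-\alpha)\eta\le|\mathcal S_\infty\cap B(x,R)|/|B(x,R)|\le(1+\alpha)\eta\}$. Densities: $U_1=\mathcal S_\infty\setminus U_0$; $\sigma^\omega_\ell(x)=|B(x,2^\ell)\cap U_1|/|B(x,2^\ell)\cap\mathcal S_\infty|$ for $x\in\mathbb{Z}^d$; for $f:\mathbb{Z}^d\to\mathbb{R}$, $(f)^\omega_{x,\ell}=|B(x,2^\ell)\cap\mathcal S_\infty|^{-1}\sum_{y\in B(x,2^\ell)\cap\mathcal S_\infty}f(y)$; convention $0/0=0$. *)

(* Defs.v *)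
From HB Require Import structures.
From mathcomp Require Import all_boot all_order all_algebra.
From mathcomp Require Import all_classical all_reals all_analysis.
From mathcomp Require Import finmap.
Set Implicit Arguments. Unset Strict Implicit. Unset Printing Implicit Defensive.
Import Order.TTheory GRing.Theory Num.Theory.
Local Open Scope classical_set_scope.
Local Open Scope ring_scope.

Definition pt (d : nat) := 'rV[int]_d.

Definition normi d (x : pt d) : nat := \max_(i < d) absz (x ord0 i).

Definition lball {R : realType} d (x : pt d) (r : R) : set (pt d) :=
  [set y | ((normi (y - x))%:R <= r)%R].

Definition adj d (x y : pt d) : bool := (\sum_(i < d) absz (x ord0 i - y ord0 i) == 1)%N.

Definition walk d (A : set (pt d)) (x y : pt d) (n : nat) : Prop :=
  exists p : seq (pt d), [/\ size p = n, path (@adj d) x p, last x p = y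
                           & forall z, z \in x :: p -> A z].

Definition connected_in d (A : set (pt d)) (x y : pt d) : Prop :=
  exists n, walk A x y n.

(** graph distance in the subgraph induced by A (+oo if not connected) *)
Definition gdist {R : realType} d (A : set (pt d)) (x y : pt d) : \bar R :=
  ereal_inf [set (n%:R)%:E | n in [set n | walk A x y n]].

Definition config d := pt d -> bool.

Definition Sset d (om : config d) : set (pt d) := [set x | om x].

Definition Sinf d (om : config d) : set (pt d) :=
  [set x | om x /\ ~ finite_set [set y | connected_in (Sset om) x y]].

(** cardinality of a finite set (0 if infinite; only used on finite sets) *)
Definition cardS d (A : set (pt d)) : nat := (#|` fset_set A|)%fset.

(** scale r_{alpha,R} = exp(kappa (log R)^{1+Delta}), with kappa = kappa_reg(alpha) *)
Definition rscale {R : realType} (kappa Delta : R) (Rr : R) : R :=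
  expR (kappa * (ln Rr) `^ (1 + Delta)).

Definition dens_good {R : realType} d (om : config d) (eta alpha kappa Delta : R)
    (Rr : R) : Prop :=
  forall x, Sinf om x -> lball 0 (rscale kappa Delta Rr) x ->
    (1 - alpha) * eta <= (cardS (Sinf om `&` lball x Rr))%:R / (cardS (lball x Rr))%:R
    <= (1 + alpha) * eta.

(** R_den(omega, alpha) in \bar R (+oo if the set is empty) *)
Definition Rden {R : realType} d (om : config d) (eta alpha kappa Delta : R) : \bar R :=
  ereal_inf [set R0%:E | R0 in
     [set R0 : R | 1 <= R0 /\ forall Rr, R0 <= Rr -> dens_good om eta alpha kappa Delta Rr]].

Definition U1 d (om : config d) (U0 : set (pt d)) : set (pt d) := Sinf om `\` U0.

(** sigma^omega_l(x) (convention 0/0 = 0, automatic in MathComp) *)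
Definition sigma {R : realType} d (om : config d) (U0 : set (pt d)) (l : nat) (x : pt d) : R :=
  (cardS (lball x (2 ^+ l : R) `&` U1 om U0))%:R / (cardS (lball x (2 ^+ l : R) `&` Sinf om))%:R.

Definition avg {R : realType} d (om : config d) (f : pt d -> R) (x : pt d) (l : nat) : R :=
  (\sum_(y \in lball x (2 ^+ l : R) `&` Sinf om) f y) / (cardS (lball x (2 ^+ l : R) `&` Sinf om))%:R.

(* Main.v *)
Require Import Defs.
From HB Require Import structures.
From mathcomp Require Import all_boot all_order all_algebra.
From mathcomp Require Import all_classical all_reals all_analysis.
From mathcomp Require Import finmap zify.
From mathcomp.algebra_tactics Require Import ring lra.
Import Order.TTheory GRing.Theory Num.Theory.
Set Implicit Arguments. Unset Strict Implicit. Unset Printing Implicit Defensive.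
Local Open Scope classical_set_scope.
Local Open Scope ring_scope.

(** (i) Moving the centre of B(x, L), L = 2^l, to a nearest neighbour changes both
    |B(x, L) ∩ U_1| and |B(x, L) ∩ S_∞| by at most one face of the cube, (2L + 1)^(d-1)
    points, while the denominator of σ_l is at least (1 - α) η (2L + 1)^d; this gives the
    bound for neighbours, and summing along a path gives the Lipschitz bound.
    (ii) Every denominator of σ_l' on B(x, L) is within (1 ± α) η (2L' + 1)^d.  Counting the
    pairs (y, z) with y ∈ B(x, L) ∩ S_∞, z ∈ U_1 and |y - z|_∞ <= L' in two ways turns the sum
    of the numerators into the sum over z ∈ U_1 ∩ B(x, L + L') of |B(z, L') ∩ B(x, L) ∩ S_∞|,
    whose terms are again within (1 ± α) η (2L' + 1)^d when B(z, L') ⊆ B(x, L).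
    Hence the sum of σ_l' over B(x, L) ∩ S_∞ lies between (1-α)/(1+α) |U_1 ∩ B(x, L - L')| and
    (1+α)/(1-α) |U_1 ∩ B(x, L + L')|, and the shells between B(x, L ± L') and B(x, L)
    contain at most d 2^(d-1) (L'/L) (2L + 1)^d points.  Nothing about U_1 beyond
    U_1 ⊆ S_∞ is used, so the argument is carried out for arbitrary sets U ⊆ S. *)

Section Cube.
Variable d : nat.
Implicit Types (c x y : pt d) (M : nat).

(* The ball B(c, M) is enumerated by the finite type of offset vectors in {0, ..., 2M}^d. *)
Definition cube M := {ffun 'I_d -> 'I_(M.*2.+1)}.

Definition cube_pt c M (g : cube M) : pt d := c + \row_i ((g i : nat)%:Z - M%:Z).
Arguments cube_pt : clear implicits.

Lemma cube_ptE c M g i : cube_pt c M g ord0 i = c ord0 i + ((g i : nat)%:Z - M%:Z).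
Proof. by rewrite !mxE. Qed.

Lemma normi_leP x M : reflect (forall i, (absz (x ord0 i) <= M)%N) (normi x <= M)%N.
Proof.
apply: (iffP idP) => [/bigmax_leqP H i | H]; first exact: H.
by apply/bigmax_leqP => i _; apply: H.
Qed.

Lemma leq_normi x i : (absz (x ord0 i) <= normi x)%N.
Proof. exact: leq_bigmax. Qed.

Lemma lball_natP {R : realType} c M y :
  lball c (M%:R : R) y <-> forall i, (absz (y ord0 i - c ord0 i) <= M)%N.
Proof.
rewrite /lball /= ler_nat; split => [/normi_leP H i | H].
  by have := H i; rewrite !mxE.
by apply/normi_leP => i; rewrite !mxE.
Qed.

Lemma cube_pt_lball {R : realType} c M g : lball c (M%:R : R) (cube_pt c M g).
Proof. by apply/lball_natP => i; rewrite cube_ptE; have := ltn_ord (g i); lia. Qed.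

Lemma cube_pt_inj c M : injective (cube_pt c M).
Proof.
move=> g g' /matrixP /(_ ord0) eq_gg'; apply/ffunP => i; apply: val_inj => /=.
by have := eq_gg' i; rewrite !cube_ptE; lia.
Qed.

Lemma lball_cube_pt {R : realType} c M y :
  lball c (M%:R : R) y -> exists g, y = cube_pt c M g.
Proof.
move=> /lball_natP By.
have lt_i i : (absz (y ord0 i - c ord0 i + M%:Z)%R < M.*2.+1)%N by have := By i; lia.
exists [ffun i => Ordinal (lt_i i)]; apply/matrixP => a i.
have -> : a = ord0 by apply/val_inj; case: a => [[]].
by rewrite cube_ptE ffunE /=; have := By i; lia.
Qed.

Lemma lball_finite {R : realType} c M : finite_set (lball c (M%:R : R)).
Proof.
have -> : lball c (M%:R : R) = cube_pt c M @` setT.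
  apply/seteqP; split => [y /lball_cube_pt [g ->] | _ [g _ <-]]; last exact: cube_pt_lball.
  by exists g.
exact/finite_image/finite_finset.
Qed.

Lemma cardS_cube {R : realType} c M (A : set (pt d)) : A `<=` lball c (M%:R : R) ->
  cardS A = (\sum_(g : cube M) (cube_pt c M g \in A))%N.
Proof.
move=> AB; have finA := sub_finite_set AB (lball_finite c M).
have AE : A = cube_pt c M @` [set g | cube_pt c M g \in A].
  apply/seteqP; split => [y Ay | _ [g /set_mem Ag <-] //].
  by have [g yE] := lball_cube_pt (AB _ Ay); exists g; rewrite //= -yE; apply/mem_set.
rewrite /cardS card_fset_sum1 -fsbig_finite // {1}AE.
rewrite fsbig_image; last by move=> g g' _ _; apply: cube_pt_inj.
rewrite -(bigfs _ _ (r := index_enum (cube M)) (P := fun g => cube_pt c M g \in A)).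
- by rewrite big_mkcond; apply: eq_bigr => g _; case: (_ \in _).
- exact: index_enum_uniq.
- by move=> g _; rewrite mem_index_enum.
Qed.

Lemma cardS_lball {R : realType} c M : cardS (lball c (M%:R : R)) = (M.*2.+1 ^ d)%N.
Proof.
rewrite (cardS_cube (@subset_refl _ _)) (eq_bigr (fun=> 1%N)).
  by rewrite sum1_card card_ffun !card_ord.
by move=> g _; rewrite (mem_set (cube_pt_lball _ _)).
Qed.

Lemma adj_coord x y : adj x y ->
  exists i, absz (x ord0 i - y ord0 i) = 1%N /\ forall j, j != i -> x ord0 j = y ord0 j.
Proof.
move=> /eqP xy.
have [i xy_i] : exists i, absz (x ord0 i - y ord0 i) != 0%N.
  apply/existsP; apply: contraT; rewrite negb_exists => /forallP eq0.
  by move: xy; rewrite big1 // => j _; apply/eqP; rewrite -[_ == _]negbK eq0.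
exists i; move: xy; rewrite (bigD1 i) //=.
set a := absz _; set rest := (\sum_(_ < _ | _) _)%N => xy.
have a1 : a = 1%N by move: xy_i xy; lia.
have rest0 : rest = 0%N by move: a1 xy; lia.
split => // j ji; move/eqP: rest0; rewrite sum_nat_eq0 => /forallP /(_ j).
by rewrite ji /= => /eqP; lia.
Qed.

Lemma card_cube_slice M i k : (k < M.*2.+1)%N ->
  #|[pred g : cube M | (g i : nat) == k]| = (M.*2.+1 ^ d.-1)%N.
Proof.
move=> kM.
pose F j := if j == i then [pred t : 'I_(M.*2.+1) | (t : nat) == k] else predT.
have -> : #|[pred g : cube M | (g i : nat) == k]| = #|(family F : simpl_pred (cube M))|.
  apply: eq_card => g; rewrite !inE; apply/idP/familyP => [/eqP gi j | /(_ i)].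
    by rewrite /F; case: eqP => [-> | _] //=; rewrite inE gi.
  by rewrite /F eqxx inE.
rewrite card_family foldrE big_map big_enum /= (bigD1 i) //= {1}/F eqxx.
have -> : #|[pred t : 'I_(M.*2.+1) | (t : nat) == k]| = 1%N.
  rewrite -(card1 (Ordinal kM)); apply: eq_card => t; rewrite !inE.
  by apply/eqP/eqP => [tk | ->] //; apply: val_inj.
rewrite mul1n (eq_bigr (fun=> M.*2.+1)); last first.
  by move=> j /negbTE ji; rewrite /F ji; apply: etrans (card_ord M.*2.+1); apply: eq_card.
by rewrite (eq_bigl (mem (predC1 i))) // prod_nat_const cardC1 card_ord.
Qed.

Lemma cardS_le (A B : set (pt d)) : finite_set B -> A `<=` B -> (cardS A <= cardS B)%N.
Proof.
move=> finB AB; have finA := sub_finite_set AB finB.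
by apply: fsubset_leq_card; rewrite -fset_set_sub.
Qed.

(* All points of B(x, M) outside B(y, M) lie on one face of the cube B(x, M). *)
Lemma cardS_lball_adj {R : realType} x y M (P : set (pt d)) : adj x y ->
  (cardS (lball x (M%:R : R) `&` P) <= cardS (lball y (M%:R : R) `&` P) + M.*2.+1 ^ d.-1)%N.
Proof.
move=> /adj_coord [i [xy_i xy_j]].
pose k := if x ord0 i - y ord0 i == 1 then M.*2 else 0%N.
have kM : (k < M.*2.+1)%N by rewrite /k; case: ifP.
have face g : ~ lball y (M%:R : R) (cube_pt x M g) -> (g i : nat) = k.
  apply: contra_notP => gik; apply/lball_natP => j; rewrite cube_ptE.
  have := ltn_ord (g j).
  case: (eqVneq j i) => [-> | /xy_j ->]; last by lia.
  by move: gik xy_i; rewrite /k; case: eqP; lia.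
have Bx : lball x (M%:R : R) `&` P `<=` lball x (M%:R : R) by move=> z [].
have Bxy : (lball x (M%:R : R) `&` P) `&` lball y (M%:R : R) `<=` lball x (M%:R : R).
  by move=> z [[]].
apply: (@leq_trans (cardS ((lball x (M%:R : R) `&` P) `&` lball y (M%:R : R))
                    + M.*2.+1 ^ d.-1)%N); last first.
  rewrite leq_add2r; apply: cardS_le; first exact/finite_setIl/lball_finite.
  by move=> z [[_ Pz] yz].
rewrite (cardS_cube Bx) (cardS_cube Bxy) -(card_cube_slice i kM) -sum1_card.
rewrite [X in (_ <= _ + X)%N]big_mkcond /= -big_split /=.
apply: leq_sum => g _; rewrite !in_setI.
case: (boolP (cube_pt x M g \in lball y (M%:R : R))) => [_ | gy].
  by rewrite andbT leq_addr.
rewrite andbF add0n inE face; first by rewrite eqxx; case: (_ && _).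
by move=> /mem_set; apply/negP.
Qed.

End Cube.

Section Balls.
Variables (R : realType) (d : nat).
Implicit Types (c x y z : pt d) (r : R).

Lemma normiN x : normi (- x) = normi x.
Proof. by apply: eq_bigr => i _; rewrite mxE abszN. Qed.

Lemma normiD x y : (normi (x + y)%R <= normi x + normi y)%N.
Proof.
apply/normi_leP => i; rewrite mxE.
have := leq_normi x i; have := leq_normi y i.
by move: (normi x) (normi y) (x ord0 i) (y ord0 i) => ? ? ? ?; lia.
Qed.

Lemma lball_sym c r y : lball c r y -> lball y r c.
Proof. by rewrite /lball /= -normiN opprB. Qed.

Lemma lballC c r : (fun y => lball y r c) = lball c r.
Proof. by apply/seteqP; split => y /lball_sym. Qed.

Lemma lball_trans c y z r1 r2 : lball c r1 y -> lball y r2 z -> lball c (r1 + r2) z.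
Proof.
rewrite /lball /= => cy yz; rewrite -(subrK y z) -addrA.
apply: le_trans (_ : (normi (z - y))%:R + (normi (y - c))%:R <= _).
  by rewrite -natrD ler_nat normiD.
by rewrite addrC lerD.
Qed.

Lemma lball_le c r1 r2 : r1 <= r2 -> lball c r1 `<=` lball c r2.
Proof. by move=> r12 y /le_trans; apply. Qed.

Lemma lball_floor c (M : nat) r : M%:R <= r -> r < M.+1%:R -> lball c r = lball c (M%:R : R).
Proof.
move=> Mr rM; apply/seteqP; split => y; rewrite /lball /= => By; last exact: le_trans Mr.
by rewrite ler_nat -ltnS -(ltr_nat R); apply: le_lt_trans rM.
Qed.

End Balls.

Section FiniteSums.
Variables (R : numDomainType) (T : choiceType).
Implicit Types (A B : set T) (F G : T -> R).

Lemma ler_fsum A F G : finite_set A ->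
  (forall x, A x -> F x <= G x) -> \sum_(x \in A) F x <= \sum_(x \in A) G x.
Proof.
move=> finA FG; rewrite !fsbig_finite //= big_seq [leRHS]big_seq.
by apply: ler_sum => x; rewrite in_fset_set // => /set_mem /FG.
Qed.

Lemma fsum_subset_le A B F : finite_set B -> A `<=` B ->
  (forall x, B x -> 0 <= F x) -> \sum_(x \in A) F x <= \sum_(x \in B) F x.
Proof.
move=> finB AB F0; rewrite [leRHS](fsbigID A) // (setIidr AB) lerDl.
by apply: fsumr_ge0 => x [/F0].
Qed.

End FiniteSums.

Section Counting.
Variables (R : realType) (d : nat).
Implicit Types (A B P Q : set (pt d)).

Lemma cardS_fsum1 A : finite_set A -> (cardS A)%:R = \sum_(x \in A) (1 : R).
Proof. by move=> finA; rewrite /cardS card_fset_sum1 natr_sum fsbig_finite. Qed.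

Lemma fsum_cst A (k : R) : finite_set A -> \sum_(x \in A) k = k * (cardS A)%:R.
Proof.
by move=> finA; rewrite cardS_fsum1 // mulr_fsumr; apply: eq_fsbigr => x _; rewrite mulr1.
Qed.

Lemma cardS_setI_fsum A B : finite_set A ->
  ((cardS (A `&` B))%:R : R) = \sum_(x \in A) ((x \in B)%:R : R).
Proof.
move=> finA; rewrite cardS_fsum1 ?fsbig_mkcondr; last exact: finite_setIl.
by apply: eq_fsbigr => x _; case: (x \in B).
Qed.

Lemma cardS_shell P1 P2 U : finite_set P2 -> P1 `<=` P2 ->
  ((cardS (P2 `&` U))%:R + (cardS P1)%:R : R) <= (cardS (P1 `&` U))%:R + (cardS P2)%:R.
Proof.
move=> finP2 P12; have -> : P1 = P2 `&` P1 by rewrite setIidr.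
rewrite -setIA !cardS_setI_fsum // cardS_fsum1 // -!fsbig_split //.
apply: ler_fsum => // x _; rewrite in_setI.
by case: (x \in P1); case: (x \in U); rewrite /=; lra.
Qed.

Lemma fsum_cardS_exchange P Q (E : pt d -> set (pt d)) : finite_set P -> finite_set Q ->
  \sum_(y \in P) ((cardS (Q `&` E y))%:R : R) = \sum_(z \in Q) ((cardS (P `&` E^~ z))%:R : R).
Proof.
move=> finP finQ; under eq_fsbigr do rewrite cardS_setI_fsum //.
by rewrite exchange_fsbig //; apply: eq_fsbigr => z _; rewrite cardS_setI_fsum.
Qed.

Lemma dist_cardS_lball_adj x y (M : nat) P : adj x y ->
  `|(cardS (lball x (M%:R : R) `&` P))%:R - (cardS (lball y (M%:R : R) `&` P))%:R|
    <= (M.*2.+1 ^ d.-1)%:R :> R.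
Proof.
move=> xy; have yx : adj y x by rewrite /adj; under eq_bigr do rewrite distnC.
by rewrite ler_distl lerBlDr -!natrD !ler_nat !cardS_lball_adj.
Qed.

End Counting.

Section RealInequalities.
Variable R : realFieldType.

Lemma dist_div_le (a b a' b' m K : R) :
  0 < K -> K <= b -> K <= b' -> 0 <= a' <= b' ->
  `|a - a'| <= m -> `|b - b'| <= m -> `|a / b - a' / b'| <= 2 * m / K.
Proof.
move=> K_gt0 Kb Kb' /andP[a'_ge0 a'b'] aa' bb'.
have b_gt0 : 0 < b := lt_le_trans K_gt0 Kb.
have b'_gt0 : 0 < b' := lt_le_trans K_gt0 Kb'.
have -> : a / b - a' / b' = (a - a' + a' / b' * (b' - b)) / b.
  by field; rewrite !gt_eqF.
have num : `|a - a' + a' / b' * (b' - b)| <= 2 * m.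
  have q_ge0 : 0 <= a' / b' by rewrite divr_ge0 // ltW.
  have q_le1 : a' / b' <= 1 by rewrite ler_pdivrMr // mul1r.
  apply: le_trans (ler_normD _ _) _; rewrite normrM (ger0_norm q_ge0).
  rewrite distrC in bb'; have := normr_ge0 (b' - b); nra.
rewrite normrM normfV (gtr0_norm b_gt0).
apply: le_trans (ler_wpM2r _ num) _; first by rewrite invr_ge0 ltW.
apply: ler_wpM2l; first by have := le_trans (normr_ge0 _) aa'; lra.
by rewrite lef_pV2.
Qed.

Lemma subrXX_le (p q : R) n : 0 <= p -> p <= q ->
  q ^+ n.+1 - p ^+ n.+1 <= n.+1%:R * q ^+ n * (q - p).
Proof.
move=> p_ge0 pq; elim: n => [|n IH]; first by rewrite !expr1 expr0; lra.
have q_ge0 : 0 <= q := le_trans p_ge0 pq.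
have pXq : p ^+ n.+1 <= q ^+ n.+1 by apply: lerXn2r; rewrite ?nnegrE.
have -> : q ^+ n.+2 - p ^+ n.+2 = q * (q ^+ n.+1 - p ^+ n.+1) + p ^+ n.+1 * (q - p).
  by rewrite !exprS; ring.
have -> : n.+2%:R * q ^+ n.+1 * (q - p) =
    q * (n.+1%:R * q ^+ n * (q - p)) + q ^+ n.+1 * (q - p).
  by rewrite exprS -[n.+2]addn1 natrD; ring.
by apply: lerD; [apply: ler_wpM2l | apply: ler_wpM2r; rewrite ?subr_ge0].
Qed.

Lemma pow_shell_le (p q B L L' : R) n : (0 < n)%N -> 0 <= p -> p <= q -> q <= 2 * B ->
  q - p = 2 * L' -> 0 <= L -> 2 * L <= B ->
  (q ^+ n - p ^+ n) * L <= n%:R * 2 ^+ n.-1 * L' * B ^+ n.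
Proof.
case: n => [//|n] _ p_ge0 pq qB qp L_ge0 LB /=.
have q_ge0 : 0 <= q := le_trans p_ge0 pq.
have cL'_ge0 : 0 <= n.+1%:R * L' by apply: mulr_ge0 => //; lra.
have qX : q ^+ n <= 2 ^+ n * B ^+ n by rewrite -exprMn lerXn2r ?nnegrE //; lra.
apply: le_trans (ler_wpM2r L_ge0 (subrXX_le n p_ge0 pq)) _.
rewrite qp exprSr.
have -> : n.+1%:R * q ^+ n * (2 * L') * L = n.+1%:R * L' * (q ^+ n * (2 * L)) by ring.
have -> : n.+1%:R * 2 ^+ n * L' * (B ^+ n * B) =
    n.+1%:R * L' * (2 ^+ n * B ^+ n * B) by ring.
by apply: ler_wpM2l => //; apply: ler_pM; rewrite ?exprn_ge0 //; lra.
Qed.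

Lemma div_le_add (T a b De k K E : R) : 0 < K -> K <= b -> 0 <= k -> 0 <= De ->
  T <= k * (a + De) -> k * De / K <= E -> T / b <= k * (a / b) + E.
Proof.
move=> K_gt0 Kb k_ge0 De_ge0 hT hE.
have b_gt0 : 0 < b := lt_le_trans K_gt0 Kb.
have binv_ge0 : 0 <= b^-1 by rewrite invr_ge0 ltW.
apply: le_trans (ler_wpM2r binv_ge0 hT) _.
rewrite mulrDr mulrDl -mulrA lerD2l; apply: le_trans hE.
by apply: ler_wpM2l; rewrite ?mulr_ge0 // lef_pV2.
Qed.

Lemma div_ge_sub (T a b De k K E : R) : 0 < K -> K <= b -> 0 <= k -> 0 <= De ->
  k * (a - De) <= T -> k * De / K <= E -> k * (a / b) - E <= T / b.
Proof.
move=> K_gt0 Kb k_ge0 De_ge0 hT hE.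
have b_gt0 : 0 < b := lt_le_trans K_gt0 Kb.
have binv_ge0 : 0 <= b^-1 by rewrite invr_ge0 ltW.
apply: le_trans (ler_wpM2r binv_ge0 hT).
rewrite mulrBr mulrBl -mulrA lerD2l lerN2; apply: le_trans hE.
by apply: (ler_wpM2l (mulr_ge0 k_ge0 De_ge0)); rewrite lef_pV2.
Qed.

Lemma shell_error_le (k De c eta N L L' alpha : R) :
  0 < 1 - alpha -> 0 < eta -> 0 < N -> 0 < L -> 0 <= De -> k <= 3 * (1 - alpha) ->
  De * L <= c * L' * N -> k * De / ((1 - alpha) * eta * N) <= 3 * c / eta * (L' / L).
Proof.
move=> alpha_lt1 eta_gt0 N_gt0 L_gt0 De_ge0 hk hDe.
apply: le_trans (_ : 3 * (1 - alpha) * De / ((1 - alpha) * eta * N) <= _).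
  by apply: ler_wpM2r; [rewrite invr_ge0 !mulr_ge0 // ltW | apply: ler_wpM2r].
have -> : 3 * (1 - alpha) * De / ((1 - alpha) * eta * N) = 3 / eta * (De / N).
  by field; rewrite !gt_eqF.
have -> : 3 * c / eta * (L' / L) = 3 / eta * (c * L' / L) by field; rewrite !gt_eqF.
apply: ler_wpM2l; first by rewrite divr_ge0 // ltW.
by rewrite ler_pdivrMr // mulrAC ler_pdivlMr.
Qed.

(* The factor 3 in c_0: for 0 <= α < 1/3 both (1+α)/(1-α)^2 and 1/(1+α) are at most 3. *)
Lemma divDB_le3 (alpha : R) : 0 <= alpha -> alpha < 1 / 3 ->
  (1 + alpha) / (1 - alpha) <= 3 * (1 - alpha).
Proof. by move=> alpha_ge0 alpha_lt; rewrite ler_pdivrMr; nra. Qed.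

Lemma divBD_le3 (alpha : R) : 0 <= alpha -> alpha < 1 / 3 ->
  (1 - alpha) / (1 + alpha) <= 3 * (1 - alpha).
Proof. by move=> alpha_ge0 alpha_lt; rewrite ler_pdivrMr; nra. Qed.

End RealInequalities.

Section Walks.
Variables (R : realType) (d : nat) (A : set (pt d)) (f : pt d -> R) (c : R).
Hypothesis f_adj : forall u v, A u -> A v -> adj u v -> `|f u - f v| <= c.

Lemma walk_dist_le x y n : walk A x y n -> `|f x - f y| <= c * n%:R.
Proof.
move=> [p [<- + <- +]]; elim: p x => [|z p IH] x /=.
  by rewrite subrr normr0 mulr0.
move=> /andP[xz pz] Ap.
have Ax : A x by apply: Ap; rewrite mem_head.
have Az : A z by apply: Ap; rewrite inE mem_head orbT.
apply: le_trans (ler_distD (f z) _ _) _.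
rewrite -addn1 natrD mulrDr mulr1 addrC lerD ?f_adj //.
by apply: IH => // w wp; apply: Ap; rewrite inE wp orbT.
Qed.

Lemma gdist_lipschitz x y : 0 < c -> (`|f x - f y|%:E <= c%:E * gdist A x y)%E.
Proof.
move=> c_gt0.
have -> : `|f x - f y|%:E = (c%:E * (`|f x - f y| / c)%:E)%E.
  by rewrite -EFinM mulrC divfK ?gt_eqF.
apply: lee_wpmul2l; first by rewrite lee_fin ltW.
apply: le_ereal_inf_tmp => _ [n /= xy <-].
by rewrite lee_fin ler_pdivrMr // mulrC walk_dist_le.
Qed.

End Walks.

Section Densities.
Variables (R : realType) (d : nat) (U S : set (pt d)) (eta alpha : R).
Hypotheses (US : U `<=` S) (eta_gt0 : 0 < eta) (alpha_ge0 : 0 <= alpha) (alpha_lt : alpha < 1 / 3).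

Let alpha_lt1 : 0 < 1 - alpha.
Proof. by have := alpha_lt; lra. Qed.

Let alpha_gtN1 : 0 < 1 + alpha.
Proof. by have := alpha_ge0; lra. Qed.

Definition rel_density (r : R) (x : pt d) : R :=
  (cardS (lball x r `&` U))%:R / (cardS (lball x r `&` S))%:R.

Definition dense_at (M : nat) (z : pt d) : bool :=
  (1 - alpha) * eta * (M.*2.+1 ^ d)%:R <= (cardS (lball z (M%:R : R) `&` S))%:R
    <= (1 + alpha) * eta * (M.*2.+1 ^ d)%:R.

Lemma rel_density_adj_le (L : nat) (u v : pt d) : (0 < d)%N -> (0 < L)%N ->
  dense_at L u -> dense_at L v -> adj u v ->
  `|rel_density L%:R u - rel_density L%:R v| <= 6 * (L%:R)^-1 / eta.
Proof.
move=> d_gt0 L_gt0 /andP[du _] /andP[dv _] uv.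
set m := (L.*2.+1 ^ d.-1)%N.
have m_gt0 : (0 : R) < m%:R by rewrite ltr0n expn_gt0.
have K_gt0 : 0 < (1 - alpha) * eta * (L.*2.+1 ^ d)%:R.
  by apply: mulr_gt0; [apply: mulr_gt0 | rewrite ltr0n expn_gt0].
have av_le_bv : (cardS (lball v (L%:R : R) `&` U) <= cardS (lball v (L%:R : R) `&` S))%N.
  by apply: cardS_le; [exact/finite_setIl/lball_finite | move=> z [vz /US]].
apply: le_trans (dist_div_le K_gt0 du dv _ (dist_cardS_lball_adj _ _ _ uv)
                   (dist_cardS_lball_adj _ _ _ uv)) _.
  by rewrite ler0n ler_nat.
have -> : (L.*2.+1 ^ d)%:R = m%:R * (2 * L%:R + 1) :> R.
  rewrite -[in LHS](prednK d_gt0) expnS mulnC natrM; congr (_ * _).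
  by rewrite -addn1 -mul2n natrD natrM.
have L_ge1 : (1 : R) <= L%:R by rewrite ler1n.
have -> : 2 * m%:R / ((1 - alpha) * eta * (m%:R * (2 * L%:R + 1))) =
    2 / ((1 - alpha) * eta * (2 * L%:R + 1)).
  by field; rewrite !gt_eqF //; have := alpha_lt1; lra.
rewrite ler_pdivrMr; last by rewrite !mulr_gt0 //; lra.
have -> : 6 * (L%:R)^-1 / eta * ((1 - alpha) * eta * (2 * L%:R + 1)) =
    6 * (1 - alpha) * (2 * L%:R + 1) / L%:R.
  by field; rewrite !gt_eqF //; lra.
by rewrite ler_pdivlMr; have := alpha_lt; nra.
Qed.

Section Average.
Variables (L L' : nat) (x : pt d).
Hypotheses (d_gt0 : (0 < d)%N) (L_gt0 : (0 < L)%N) (L'_le_L : (L' <= L)%N).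
Hypothesis dense_x :
  (1 - alpha) * eta * (L.*2.+1 ^ d)%:R <= (cardS (lball x (L%:R : R) `&` S))%:R.
Hypothesis dense_near : forall z, S z -> lball x ((L + L')%:R : R) z -> dense_at L' z.

Let D := lball x (L%:R : R) `&` S.
Let N' : R := (L'.*2.+1 ^ d)%:R.

Let N'_gt0 : 0 < N'.
Proof. by rewrite ltr0n expn_gt0. Qed.

Let finD : finite_set D.
Proof. exact/finite_setIl/lball_finite. Qed.

Let lballI_finite (M : nat) (c : pt d) (A : set (pt d)) : finite_set (lball c (M%:R : R) `&` A).
Proof. exact/finite_setIl/lball_finite. Qed.

Let lball_sub_LL' : lball x (L%:R : R) `<=` lball x ((L + L')%:R : R).
Proof. by apply: lball_le; rewrite ler_nat leq_addr. Qed.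

Lemma sum_cardS_lball_exchange :
  \sum_(y \in D) ((cardS (lball y (L'%:R : R) `&` U))%:R : R) =
  \sum_(z \in lball x ((L + L')%:R : R) `&` U) ((cardS (D `&` lball z (L'%:R : R)))%:R : R).
Proof.
set Q := lball x ((L + L')%:R : R) `&` U.
have finQ : finite_set Q by exact: lballI_finite.
rewrite (eq_fsbigr (fun y => (cardS (Q `&` lball y (L'%:R : R)))%:R)).
  rewrite [LHS](fsum_cardS_exchange _ (fun y => lball y (L'%:R : R))) //.
  by apply: eq_fsbigr => z _; rewrite lballC.
move=> y /set_mem [By _]; congr (_%:R); congr cardS.
apply/seteqP; split => [z [yz Uz] | z [[_ Uz] yz]] //; split => //; split => //.
by rewrite natrD; apply: lball_trans By yz.
Qed.

Lemma sum_rel_density_le : \sum_(y \in D) rel_density L'%:R y <=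
  (1 + alpha) / (1 - alpha) * (cardS (lball x ((L + L')%:R : R) `&` U))%:R.
Proof.
set Q := lball x ((L + L')%:R : R) `&` U.
have K_gt0 : 0 < (1 - alpha) * eta * N' by rewrite !mulr_gt0.
apply: le_trans (_ : \sum_(y \in D) (cardS (lball y (L'%:R : R) `&` U))%:R /
                                     ((1 - alpha) * eta * N') <= _).
  apply: ler_fsum => // y [By Sy]; have /andP[Ky _] := dense_near Sy (lball_sub_LL' By).
  by apply: ler_wpM2l => //; rewrite lef_pV2 ?posrE // (lt_le_trans K_gt0 Ky).
rewrite -mulr_fsuml sum_cardS_lball_exchange.
apply: le_trans (_ : (\sum_(z \in Q) (1 + alpha) * eta * N') / ((1 - alpha) * eta * N') <= _).
  apply: ler_wpM2r; first by rewrite invr_ge0 ltW.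
  apply: ler_fsum => [|z [Bz Uz]]; first exact: lballI_finite.
  have /andP[_ Kz] := dense_near (US Uz) Bz; apply: le_trans Kz; rewrite ler_nat.
  by apply: cardS_le => [|w [[_ Sw] zw]] //; exact: lballI_finite.
rewrite fsum_cst; last exact: lballI_finite.
by rewrite le_eqVlt; apply/orP; left; apply/eqP; field; rewrite !gt_eqF.
Qed.

Lemma sum_rel_density_ge : (1 - alpha) / (1 + alpha) *
  (cardS (lball x ((L - L')%:R : R) `&` U))%:R <= \sum_(y \in D) rel_density L'%:R y.
Proof.
set Q := lball x ((L + L')%:R : R) `&` U; set Q' := lball x ((L - L')%:R : R) `&` U.
have Q'Q : Q' `<=` Q.
  move=> z [Bz Uz]; split => //; apply: lball_le Bz.
  by rewrite ler_nat (leq_trans (leq_subr _ _) (leq_addr _ _)).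
have K_gt0 : 0 < (1 - alpha) * eta * N' by rewrite !mulr_gt0.
have K'_gt0 : 0 < (1 + alpha) * eta * N' by rewrite !mulr_gt0.
apply: le_trans (_ : \sum_(y \in D) (cardS (lball y (L'%:R : R) `&` U))%:R /
                                     ((1 + alpha) * eta * N') <= _); last first.
  apply: ler_fsum => // y [By Sy]; have /andP[Ky K'y] := dense_near Sy (lball_sub_LL' By).
  by apply: ler_wpM2l => //; rewrite lef_pV2 ?posrE // (lt_le_trans K_gt0 Ky).
rewrite -mulr_fsuml sum_cardS_lball_exchange.
apply: le_trans (_ : (\sum_(z \in Q') (1 - alpha) * eta * N') / ((1 + alpha) * eta * N') <= _).
  rewrite fsum_cst; last exact: lballI_finite.
  by rewrite le_eqVlt; apply/orP; left; apply/eqP; field; rewrite !gt_eqF.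
apply: ler_wpM2r; first by rewrite invr_ge0 ltW.
apply: le_trans (fsum_subset_le (lballI_finite _ _ _) Q'Q (fun z _ => ler0n _ _)).
apply: ler_fsum => [|z [Bz Uz]]; first exact: lballI_finite.
have /andP[Kz _] := dense_near (US Uz) (Q'Q _ (conj Bz Uz)).1.
apply: le_trans Kz _; rewrite ler_nat; apply: cardS_le => [|w [zw Sw]]; first exact/finite_setIl/finD.
split=> //; split=> //; have := lball_trans Bz zw; by rewrite -natrD subnK.
Qed.

Lemma avg_rel_density_bounds :
  (1 - alpha) / (1 + alpha) * rel_density L%:R x - 3 * d%:R * 2 ^+ d.-1 / eta * (L'%:R / L%:R)
  <= (\sum_(y \in D) rel_density L'%:R y) / (cardS D)%:R
  <= (1 + alpha) / (1 - alpha) * rel_density L%:R x + 3 * d%:R * 2 ^+ d.-1 / eta * (L'%:R / L%:R).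
Proof.
set NL : R := (L.*2.+1 ^ d)%:R.
set a : R := (cardS (lball x (L%:R : R) `&` U))%:R.
have K_gt0 : 0 < (1 - alpha) * eta * NL by rewrite !mulr_gt0 // ltr0n expn_gt0.
have oddE M : (M.*2.+1)%:R = 2 * M%:R + 1 :> R by rewrite -addn1 -mul2n natrD natrM.
have grow M1 M2 : (M1 <= M2 <= L.*2)%N -> M2 = (M1 + L')%N ->
    ((M2.*2.+1 ^ d)%:R - (M1.*2.+1 ^ d)%:R) * L%:R <=
    d%:R * 2 ^+ d.-1 * L'%:R * (L.*2.+1 ^ d)%:R :> R.
  move=> /andP[M12 M2L] M2E.
  rewrite !natrX; apply: pow_shell_le; rewrite ?ler_nat ?ler0n //; first lia.
  - have h : (M2.*2.+1)%:R <= (2 * L.*2.+1)%:R :> R by rewrite ler_nat; lia.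
    by rewrite natrM in h.
  - by rewrite M2E !oddE natrD; ring.
  - by rewrite oddE lerDl.
have De_ge0 M1 M2 : (M1 <= M2)%N -> 0 <= (M2.*2.+1 ^ d)%:R - (M1.*2.+1 ^ d)%:R :> R.
  by move=> M12; rewrite subr_ge0 ler_nat leq_exp2r // ltnS leq_double.
have lballI_finitex M : finite_set (lball x (M%:R : R)) by exact: lball_finite.
have shell_out : (cardS (lball x ((L + L')%:R : R) `&` U))%:R <= a + (((L + L').*2.+1 ^ d)%:R - NL).
  have := cardS_shell R U (lballI_finitex (L + L')%N) lball_sub_LL'.
  by rewrite !cardS_lball -/NL -/a addrA lerBrDr.
have shell_in : a - (NL - ((L - L').*2.+1 ^ d)%:R) <= (cardS (lball x ((L - L')%:R : R) `&` U))%:R.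
  have sub : lball x ((L - L')%:R : R) `<=` lball x (L%:R : R).
    by apply: lball_le; rewrite ler_nat leq_subr.
  have := cardS_shell R U (lballI_finitex L) sub.
  by rewrite !cardS_lball -/NL -/a opprB addrA lerBlDr.
rewrite -[3 * d%:R * _]mulrA; apply/andP; split.
- apply: (div_ge_sub (De := NL - ((L - L').*2.+1 ^ d)%:R) K_gt0 dense_x).
  + by rewrite divr_ge0 // ltW.
  + by apply: De_ge0; rewrite leq_subr.
  + apply: le_trans sum_rel_density_ge; apply: ler_wpM2l shell_in.
    by rewrite divr_ge0 // ltW.
  + apply: shell_error_le; rewrite ?ltr0n ?expn_gt0 //.
    * by apply: De_ge0; rewrite leq_subr.
    * exact: divBD_le3.
    * apply: (grow (L - L')%N L); last by rewrite subnK.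
      by rewrite leq_subr -addnn leq_addr.
- apply: (div_le_add (De := ((L + L').*2.+1 ^ d)%:R - NL) K_gt0 dense_x).
  + by rewrite divr_ge0 // ltW.
  + by apply: De_ge0; rewrite leq_addr.
  + apply: le_trans sum_rel_density_le _; apply: ler_wpM2l shell_out.
    by rewrite divr_ge0 // ltW.
  + apply: shell_error_le; rewrite ?ltr0n ?expn_gt0 //.
    * by apply: De_ge0; rewrite leq_addr.
    * exact: divDB_le3.
    * by apply: (grow L (L + L')%N) => //; rewrite leq_addr -addnn leq_add2l.
Qed.

End Average.

End Densities.

Section Scales.
Variables (R : realType) (d : nat) (om : config d) (eta alpha kappa Delta : R).
Hypotheses (kappa_gt0 : 0 < kappa) (Delta_gt0 : 0 < Delta).

Lemma ler_rscale (a b : R) : 1 <= a -> a <= b -> rscale kappa Delta a <= rscale kappa Delta b.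
Proof.
move=> a_ge1 ab; rewrite /rscale ler_expR ler_pM2l //.
apply: ge0_ler_powR; first by rewrite addr_ge0 ?ler01 // ltW.
- by rewrite nnegrE ln_ge0.
- by rewrite nnegrE ln_ge0 // (le_trans a_ge1).
- by rewrite ler_ln ?posrE // (lt_le_trans ltr01) // (le_trans a_ge1).
Qed.

Lemma Rden_le_dens_good (r Rr : R) : (Rden om eta alpha kappa Delta <= r%:E)%E -> r < Rr ->
  dens_good om eta alpha kappa Delta Rr.
Proof.
move=> Rden_le r_lt.
have /ereal_inf_lt [_ [R0 [_ good] <-]] : (Rden om eta alpha kappa Delta < Rr%:E)%E.
  by apply: le_lt_trans Rden_le _; rewrite lte_fin.
by rewrite lte_fin => /ltW; apply: good.
Qed.

Lemma dens_good_dense_at (r : R) (M : nat) (z : pt d) : M%:R <= r -> r < M.+1%:R ->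
  dens_good om eta alpha kappa Delta r -> Sinf om z -> lball 0 (rscale kappa Delta r) z ->
  dense_at (Sinf om) eta alpha M z.
Proof.
move=> Mr rM good Sz Bz; have := good z Sz Bz.
rewrite /dense_at (lball_floor _ Mr rM) cardS_lball setIC.
have N_gt0 : (0 : R) < (M.*2.+1 ^ d)%:R by rewrite ltr0n expn_gt0.
move=> /andP[lo hi]; apply/andP; split; first by rewrite -ler_pdivlMr.
by rewrite -ler_pdivrMr.
Qed.

(* [Rden] is an infimum, so the density property is only known strictly above it: apply it at
   the radius [M + 1/2], whose balls are those of radius [M]. *)
Lemma Rden_le_dense_at (r : R) (M : nat) (z : pt d) :
  (Rden om eta alpha kappa Delta <= r%:E)%E -> r <= M%:R -> (0 < M)%N ->
  Sinf om z -> lball 0 (rscale kappa Delta M%:R) z -> dense_at (Sinf om) eta alpha M z.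
Proof.
move=> Rden_le rM M_gt0 Sz Bz; have half_gt0 : (0 : R) < 1 / 2 by rewrite divr_gt0.
apply: (dens_good_dense_at (r := M%:R + 1 / 2)) Sz _.
- by rewrite lerDl ltW.
- have -> : M.+1%:R = M%:R + 1 :> R by rewrite -addn1 natrD.
  by rewrite ltrD2l ltr_pdivrMr // mul1r ltr1n.
- by apply: (Rden_le_dens_good Rden_le); apply: le_lt_trans rM _; rewrite ltrDl.
- by apply: lball_le Bz; apply: ler_rscale; rewrite ?ler1n // lerDl ltW.
Qed.

End Scales.

Theorem lemma4p3 (R : realType) (d : nat) (eta alpha kappa Delta : R)
  (om : config d) (U0 : set (pt d)) (l l' : nat) :
  (3 <= d)%N -> 0 < eta -> 0 < kappa -> 0 < Delta ->
  0 < alpha -> alpha < 1 / 3 ->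
  (exists x, Sinf om x) ->
  (forall x y, Sinf om x -> Sinf om y -> connected_in (Sinf om) x y) ->
  (Rden om eta alpha kappa Delta < +oo)%E ->
  U0 `<=` Sinf om ->
  (l' < l)%N ->
  (Rden om eta alpha kappa Delta <= (2 ^+ l' : R)%:E)%E ->
  0 < rscale kappa Delta (2 ^+ l') - 2 ^+ l - 2 ^+ l' ->
  (forall x y : pt d,
     let A := Sinf om `&` lball 0 (rscale kappa Delta (2 ^+ l)) in
     A x -> A (x + y) -> connected_in A x (x + y) ->
     ((`|sigma om U0 l x - sigma om U0 l (x + y)%R|)%:E
        <= (6 * (2 ^+ l)^-1 / eta)%:E * gdist A x (x + y)%R)%E)
  /\
  (forall x : pt d,
     Sinf om x -> lball 0 (rscale kappa Delta (2 ^+ l') - 2 ^+ l - 2 ^+ l') x ->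
     let c0 := 3 * d%:R * 2 ^+ d.-1 / eta in
     let s := sigma om U0 l x in
     let a := avg om (sigma om U0 l') x l in
     (1 - alpha) / (1 + alpha) * s - c0 * (2 ^+ l' / 2 ^+ l) <= a
       <= (1 + alpha) / (1 - alpha) * s + c0 * (2 ^+ l' / 2 ^+ l)).
Proof.
move=> d_ge3 eta_gt0 kappa_gt0 Delta_gt0 alpha_gt0 alpha_lt _ _ _ _ l'_lt_l Rden_le _.
have d_gt0 : (0 < d)%N by apply: leq_trans d_ge3.
have U1S : U1 om U0 `<=` Sinf om by move=> z [].
have sigmaE k : sigma om U0 k = rel_density (U1 om U0) (Sinf om) ((2 ^ k)%:R : R).
  by apply/funext => z; rewrite /sigma /rel_density natrX.
set L := (2 ^ l)%N; set L' := (2 ^ l')%N.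
have L'_le_L : (L' <= L)%N by rewrite leq_pexp2l // ltnW.
have [L_gt0 L'_gt0] : (0 < L)%N /\ (0 < L')%N by rewrite !expn_gt0.
have [eL eL'] : (2 ^+ l : R) = L%:R /\ (2 ^+ l' : R) = L'%:R by rewrite !natrX.
rewrite /avg !sigmaE -/L -/L' eL eL' in Rden_le *.
have dense M z : (L' <= M)%N -> Sinf om z -> lball 0 (rscale kappa Delta M%:R) z ->
    dense_at (Sinf om) eta alpha M z.
  move=> L'M; apply: (Rden_le_dense_at kappa_gt0 Delta_gt0 Rden_le); rewrite ?ler_nat //.
  exact: leq_trans L'_gt0 L'M.
split => [x y Ax Axy _ | x Sx Bx].
  apply: (@gdist_lipschitz _ _ _ (rel_density (U1 om U0) (Sinf om) L%:R))
    => [u v [Su Bu] [Sv Bv] uv |]; last by rewrite !mulr_gt0 ?invr_gt0 ?ltr0n.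
  exact: (rel_density_adj_le U1S eta_gt0 alpha_lt d_gt0 L_gt0
            (dense _ _ L'_le_L Su Bu) (dense _ _ L'_le_L Sv Bv) uv).
have radiusE : rscale kappa Delta L'%:R - L%:R - L'%:R + (L + L')%:R = rscale kappa Delta L'%:R.
  by rewrite natrD; ring.
have /andP[dense_x _] : dense_at (Sinf om) eta alpha L x.
  apply: (dense _ _ L'_le_L Sx); apply: lball_le Bx.
  have rsc : rscale kappa Delta L'%:R <= rscale kappa Delta L%:R.
    by apply: ler_rscale; rewrite ?ler1n ?ler_nat.
  by apply: le_trans rsc; rewrite -[leRHS]radiusE lerDl.
apply: (avg_rel_density_bounds U1S eta_gt0 (ltW alpha_gt0) alpha_lt d_gt0 L_gt0 L'_le_L dense_x).
by move=> z Sz Bz; apply: (dense _ _ (leqnn _) Sz); rewrite -radiusE; apply: lball_trans Bx Bz.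
Qed.
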